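(* Let $Y$ be a discrete random variable with values in $\mathbb{N}_0=\{0,1,2,\ldots\}$ and probabilities $p_n=\mathbf{P}[Y=n]>0$ for all $n\in\mathbb{N}_0$, $\sum_{n=0}^\infty p_n=1$. Suppose that $Y$ has finite moments of all orders and that for some integer $n_0\ge2$ $$\sum_{n\ge n_0}\frac{-\ln p_n}{n^2\,\ln n}=\infty .$$ Assume further that the sequence $\dfrac{-\ln(\frac12 p_n)}{\ln n}$, $n=n_0,n_0+1,\ldots$, is monotone increasing and tends to $\infty$ as $n\to\infty$. Then $Y$ satisfies Carleman's condition (Stieltjes case), $\sum_{k=1}^\infty(\mathbf{E}[Y^k])^{-1/(2k)}=\infty$, and hence $Y$ is M-determinate (on $\mathbb{R}_+=[0,\infty)$). Moreover, $Y^2$ is also M-determinate on $\mathbb{R}_+$.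
   Context: A random variable with values in $\mathbb{R}_+=[0,\infty)$ and all moments finite is called M-determinate on $\mathbb{R}_+$ if its distribution is the only probability distribution on $\mathbb{R}_+$ having its moment sequence. ''Monotone increasing'' is understood in the usual sense of non-decreasing. *)

(* Defs.v *)
From HB Require Import structures.
From mathcomp Require Import all_boot all_order all_algebra.
From mathcomp Require Import all_classical all_reals all_analysis.
From mathcomp Require Import measurable_realfun.

Set Implicit Arguments.
Unset Strict Implicit.
Unset Printing Implicit Defensive.

Import Order.TTheory GRing.Theory Num.Theory.
Import numFieldNormedType.Exports.

Local Open Scope classical_set_scope.
Local Open Scope ring_scope.

(* The competing law mu ranges over all Borel probabilities on R concentrated
   on [0, +oo[; its moments are integrals of mu-a.e. nonnegative functions, and
   are finite as soon as they agree with those of X. *)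
Definition M_determinate (d : measure_display) (T : measurableType d)
    (R : realType) (P : probability T R) (X : {RV P >-> R}) : Prop :=
  [/\ (forall t, 0 <= X t),
      (forall k : nat, 'E_P[(X : T -> R) ^+ k] < +oo)%E &
      forall mu : probability R R,
        mu `[0, +oo[%classic = 1%E ->
        (forall k : nat, \int[mu]_x (x ^+ k)%:E = 'E_P[(X : T -> R) ^+ k])%E ->
        forall A : set R, measurable A ->
          mu A = distribution P X A].

Definition Carleman_Stieltjes (d : measure_display) (T : measurableType d)
    (R : realType) (P : probability T R) (X : {RV P >-> R}) : Prop :=
  (\sum_(1 <= k <oo)
     ((fine 'E_P[(X : T -> R) ^+ k]) `^ (- (2 * k%:R)^-1))%:E = +oo)%E.

Arguments M_determinate {d T R} P X.
Arguments Carleman_Stieltjes {d T R} P X.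

(* Main.v *)
(** The even moments of [Y] satisfy [E Y^(2j) <= C N_0^2 ... N_(j-1)^2], where
    [N_j] is the first [n] at which [- ln (p n / 2) / ln n] exceeds [2j + 4]:
    for [n <= N_j] the induction on [j] gains the factor [N_j^2], and for
    [n > N_j] already [n^(2j+4) p n <= 2].  Counting the [N_j] below [n] turns
    the divergence hypothesis into the divergence of the sum of the [1 / N_j],
    which gives Carleman's condition.

    For determinacy, let [X >= 0] be any variable with the same even moments as
    [Y] ([X = x] for [Y], [X = sqrt x] for [Y^2]).  The function
    [s |-> E cos (s Y) - E cos (s X)] is flat at 0 and lies in a quasi-analytic
    class, hence vanishes for [s >= 0].  At [s = 2 pi] this forces [X] to be
    integer-valued, and averaging [cos (s m) cos (s X)] over the [s = 2 pi j / K]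
    then identifies the point masses of [X]. *)
Require Import Defs.
From HB Require Import structures.
From mathcomp Require Import all_boot all_order all_algebra.
From mathcomp Require Import all_classical all_reals all_analysis.
From mathcomp Require Import measurable_realfun ring lra.

Set Implicit Arguments.
Unset Strict Implicit.
Unset Printing Implicit Defensive.

Import Order.TTheory GRing.Theory Num.Theory.
Import numFieldNormedType.Exports.

Local Open Scope classical_set_scope.
Local Open Scope ring_scope.

(** * Derivatives of the cosine and their Taylor polynomials *)

Section iterated_cosine.
Variable R : realType.
Implicit Types (t d : R) (n m : nat).

(** The [n]-th derivative of the cosine; the phase shift avoids a case split on [n] modulo 4. *)
Definition dcos n t : R := cos (t + n%:R * (pi / 2)).

Lemma dcosS n t : dcos n.+1 t = - sin (t + n%:R * (pi / 2)).
Proof. by rewrite /dcos -natr1 mulrDl mul1r addrA cosDpihalf. Qed.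

Lemma dcos0 t : dcos 0 t = cos t.
Proof. by rewrite /dcos mul0r addr0. Qed.

Lemma normr_dcos_le1 n t : `|dcos n t| <= 1.
Proof. by rewrite /dcos ler_norml cos_geN1 cos_le1. Qed.

Lemma dcos_odd0 n : odd n -> dcos n 0 = 0.
Proof.
move=> on; rewrite /dcos add0r -(odd_double_half n) on natrD -muln2 natrM.
have -> : (true%:R + n./2%:R * 2%:R) * (pi / 2) = pi / 2 + pi *+ n./2 :> R.
  by rewrite -[pi *+ _]mulr_natl mulrDl mul1r -mulrA [2%:R * _]mulrC divfK.
elim: n./2 => [|k IH]; first by rewrite mulr0n addr0 cos_pihalf.
by rewrite [pi *+ k.+1]mulrSr addrA cosDpi IH oppr0.
Qed.

Let is_derive_dcos n t : is_derive t 1 (dcos n) (dcos n.+1 t).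
Proof.
rewrite dcosS.
have h : is_derive t 1 (fun x : R => x + n%:R * (pi / 2)) (1 + 0).
  exact: (is_deriveD (is_derive_id _ _) (is_derive_cst _ _ _)).
by have := is_derive1_comp (is_derive_cos _) h; rewrite addr0 mulr1.
Qed.

Let is_derive_exp_sum (a : nat -> R) m d :
  is_derive d 1 (fun x => \sum_(j < m.+1) a j * x ^+ j / j`!%:R)
    (\sum_(j < m) a j.+1 * d ^+ j / j`!%:R).
Proof.
elim: m => [|m IH].
  rewrite big_ord0; have -> : (fun x => \sum_(j < 1) a j * x ^+ j / j`!%:R)
    = cst (a 0) by apply/funext => x; rewrite big_ord1 expr0 mulr1 divr1.
  exact: is_derive_cst.
have dX : is_derive d 1 (fun x : R => x ^+ m.+1) (m.+1%:R * d ^+ m).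
  apply: DeriveDef; first exact: exprn_derivable.
  by rewrite exp_derive [LHS]mulr1.
have := is_deriveD IH (is_deriveZ (a m.+1 / m.+1`!%:R) dX).
have -> : (fun x => \sum_(j < m.+2) a j * x ^+ j / j`!%:R)
    = (fun x => \sum_(j < m.+1) a j * x ^+ j / j`!%:R)
      + (a m.+1 / m.+1`!%:R) \*: (fun x : R => x ^+ m.+1).
  by apply/funext => x; rewrite big_ord_recr/= mulrAC.
rewrite big_ord_recr/= => h.
suff <- : (a m.+1 / m.+1`!%:R) *: (m.+1%:R * d ^+ m)
    = a m.+1 * d ^+ m / m`!%:R by [].
rewrite factS natrM /GRing.scale/=.
have f0 : m`!%:R != 0 :> R by rewrite pnatr_eq0 -lt0n fact_gt0.
have m0 : m.+1%:R != 0 :> R by rewrite pnatr_eq0.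
by move: m`!%:R m.+1%:R f0 m0 => u v u0 v0; field; rewrite u0 v0.
Qed.

(** Induction on [m]: the derivative in [d] of the remainder of order [m.+1] for [dcos n] is the
    remainder of order [m] for [dcos n.+1]. The mean value theorem is used in place of integration,
    so the bound comes without a factor [1 / m!]. *)
Lemma dcos_taylor m n t d : 0 <= d ->
  `|dcos n (t + d) - \sum_(j < m) dcos (n + j) t * d ^+ j / j`!%:R| <= d ^+ m.
Proof.
elim: m n d => [|m IH] n d d0.
  by rewrite big_ord0 subr0 expr0 normr_dcos_le1.
pose g x := dcos n (t + x) - \sum_(j < m.+1) dcos (n + j) t * x ^+ j / j`!%:R.
pose g' x := dcos n.+1 (t + x)
  - \sum_(j < m) dcos (n.+1 + j) t * x ^+ j / j`!%:R.
have dg (x : R) : is_derive x 1 g (g' x).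
  rewrite /g'; under eq_bigr do rewrite addSnnS.
  apply: is_deriveB (is_derive_exp_sum (fun j => dcos (n + j) t) m x).
  have h : is_derive x 1 (fun x : R => t + x) (0 + 1).
    exact: (is_deriveD (is_derive_cst _ _ _) (is_derive_id _ _)).
  have := is_derive1_comp (is_derive_dcos n (t + x)) h.
  by rewrite add0r mulr1.
have [c] := @MVT_segment _ g g' 0 d d0 (fun x _ => dg x) (derivable_within_continuous (fun x _ => @ex_derive _ _ _ _ _ _ _ (dg x))).
rewrite in_itv/= => /andP[c0 cd].
have -> : g 0 = 0.
  rewrite /g addr0 big_ord_recl/= addn0 expr0 mulr1 divr1 big1 ?addr0 ?subrr//.
  by move=> i _; rewrite expr0n/= mulr0 mul0r.
rewrite !subr0 -/(g d) => ->; rewrite normrM exprSr (ger0_norm d0).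
by rewrite ler_wpM2r// (le_trans (IH _ _ c0))// lerXn2r.
Qed.

End iterated_cosine.

(* A quasi-analytic uniqueness theorem in the style of Bang: if
   [|f n| <= M n * 2^(n - N.+1)] at [y], Taylor's formula of order [N.+1 - n]
   gives the same with [N] in place of [N.+1] on [[y, y + 1 / (4 L N)]]. *)
Section bang.
Variables (R : realType) (f : nat -> R -> R) (C : R) (L : nat -> R).
Hypothesis C0 : 0 <= C.
Hypothesis L0 : forall n, 0 < L n.
Hypothesis L_nd : {homo L : m n / (m <= n)%N >-> m <= n}.
Hypothesis L_div : forall B : R, exists n, B <= \sum_(i < n) (L i)^-1.

Let M n := C * \prod_(i < n) L i.

Hypothesis f_taylor : forall n m (x h : R), 0 <= x -> 0 <= h ->
  `|f n (x + h) - \sum_(j < m) f (n + j) x * h ^+ j / j`!%:R|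
    <= M (n + m) * h ^+ m.
Hypothesis f_at0 : forall n, f n 0 = 0.

Let M0 n : 0 <= M n.
Proof. by rewrite mulr_ge0// prodr_ge0// => i _; exact: ltW. Qed.

(** The extra factors are [L n], ..., [L (n + j - 1)], all of index at most [N]; hence the range up
    to [N.+1]. *)
Let MD n j N : (n + j <= N.+1)%N -> M (n + j) <= M n * L N ^+ j.
Proof.
elim: j => [|j IH]; first by rewrite addn0 expr0 mulr1.
rewrite addnS ltnS => njN; rewrite exprSr mulrA.
have -> : M (n + j).+1 = M (n + j) * L (n + j)%N.
  by rewrite /M big_ord_recr/= mulrA.
by rewrite ler_pM// ?L_nd// ?IH// ?(ltW (L0 _))// leqW.
Qed.

(** The content lies in the indices [n < N]: for [n >= N] this is no stronger than [normf_le]. *)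
Let ctrl N x := forall n, `|f n x| <= M n * 2 ^+ n / 2 ^+ N.

Let normf_le n (x : R) : 0 <= x -> `|f n x| <= M n.
Proof.
move=> x0; have := @f_taylor n 0 x 0 x0 (lexx _).
by rewrite addr0 big_ord0 subr0 expr0 mulr1 addn0.
Qed.

Let ctrl_step N (y h : R) : 0 <= y -> 0 <= h -> h * (4 * L N) <= 1 ->
  ctrl N.+1 y -> ctrl N (y + h).
Proof.
move=> y0 h0 hL cN n.
have [Nn|nN] := leqP N n.
  rewrite (le_trans (normf_le _ (addr_ge0 y0 h0)))// -mulrA ler_peMr//.
  by rewrite ler_pdivlMr ?exprn_gt0// mul1r ler_eXn2l// ltr1n.
(* This order makes the remainder involve [M N.+1], the last index that [MD] reaches. *)
pose m := (N.+1 - n)%N; have nm : (n + m)%N = N.+1 by rewrite subnKC// leqW// ltnW.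
have q0 : 0 <= h * L N by rewrite mulr_ge0// ltW.
have q4 : h * L N <= 4^-1 by lra.
(* [K] is the bound given by [ctrl N.+1], and [K * 2] the one to prove. The [j]-th Taylor term costs
   a factor [(2 h L N)^j <= 2^-j], and the remainder fits as the term [j = m] of the same geometric
   series. *)
pose K := M n * 2 ^+ n / 2 ^+ N.+1.
have K0 : 0 <= K.
  by apply: divr_ge0; rewrite ?exprn_ge0//; apply: mulr_ge0; rewrite ?exprn_ge0 ?M0.
have bnd j : 2 ^+ j * (h * L N) ^+ j <= 2^-1 ^+ j.
  by rewrite -exprMn; apply: lerXn2r; rewrite ?nnegrE; lra.
have term j : (j < m)%N ->
    `|f (n + j) y * h ^+ j / j`!%:R| <= K * 2^-1 ^+ j.
  move=> jm; rewrite normrM normfV (ger0_norm (ler0n _ _)).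
  rewrite ler_pdivrMr ?ltr0n ?fact_gt0//.
  rewrite (@le_trans _ _ (K * 2^-1 ^+ j))//; last first.
    by rewrite ler_peMr ?ler1n ?fact_gt0// mulr_ge0// exprn_ge0// invr_ge0.
  rewrite normrM (ger0_norm (exprn_ge0 _ h0)).
  apply: (le_trans (ler_wpM2r (exprn_ge0 j h0) (cN (n + j)%N))).
  rewrite (@le_trans _ _ (K * (2 ^+ j * (h * L N) ^+ j)))//; last exact: ler_wpM2l.
  rewrite /K exprD exprMn.
  have njN : (n + j <= N.+1)%N by rewrite -nm leq_add2l ltnW.
  have := MD njN => /(ler_wpM2r (_ : 0 <= 2 ^+ n * 2 ^+ j / 2 ^+ N.+1 * h ^+ j)).
  move=> /(_ _)/le_trans; rewrite !mulrA => -> //.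
    by rewrite !(mulr_ge0, invr_ge0, exprn_ge0).
  by rewrite le_eqVlt; apply/orP; left; apply/eqP; ring.
have rest : M (n + m) * h ^+ m <= K * 2^-1 ^+ m.
  apply: (@le_trans _ _ (K * (2 ^+ m * (h * L N) ^+ m))); last exact: ler_wpM2l.
  have -> : K * (2 ^+ m * (h * L N) ^+ m) = M n * L N ^+ m * h ^+ m.
    rewrite /K -nm exprD exprMn; field.
    by rewrite !expf_neq0.
  by rewrite ler_wpM2r ?exprn_ge0// MD// nm.
have geo : \sum_(j < m.+1) (2^-1 : R) ^+ j <= 2.
  have := subrX1 (2^-1 : R) m.+1.
  have : 0 <= (2^-1 : R) ^+ m.+1 by rewrite exprn_ge0// invr_ge0.
  set S := \sum_(i < _) _; set q := (_ ^+ _) => ? ?; lra.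
have -> : M n * 2 ^+ n / 2 ^+ N = K * 2.
  by rewrite /K exprS; field; rewrite expf_neq0.
rewrite -[f n _](subrK (\sum_(j < m) f (n + j) y * h ^+ j / j`!%:R)).
apply: (le_trans (ler_normD _ _)).
apply: (@le_trans _ _ (K * \sum_(j < m.+1) (2^-1 : R) ^+ j)); last exact: ler_wpM2l.
rewrite big_ord_recr/= mulrDr addrC lerD//.
  apply: (le_trans (ler_norm_sum _ _ _)).
  by rewrite mulr_sumr ler_sum// => j _; exact: term.
exact: (le_trans (@f_taylor n m y h y0 h0)).
Qed.

(** At [0] every level of control holds. Walking from [0] to [x] loses one level per step, and since
    the admissible step lengths have divergent sum, a high enough starting level leaves level [N] at
    [x]. Then [N] tends to infinity. *)
Lemma bang_vanish (x : R) : 0 <= x -> f 0 x = 0.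
Proof.
move=> x0.
suff ctrl_all N : ctrl N x.
  apply/eqP; rewrite -normr_le0; apply/ler_addgt0Pl => e e0; rewrite addr0.
  have [N CN] : exists N : nat, C / e < N%:R.
    exists (Num.Def.truncn (C / e)).+1; exact: truncnS_gt.
  have := ctrl_all N 0; rewrite expr0 mulr1 /M big_ord0 mulr1 => /le_trans; apply.
  rewrite ler_pdivrMr ?exprn_gt0// mulrC -ler_pdivrMr//.
  by rewrite (le_trans (ltW CN))// -natrX ler_nat ltnW// ltn_expl.
have ctrl0 K : ctrl K 0.
  move=> n; rewrite f_at0 normr0; apply: divr_ge0; rewrite ?exprn_ge0//.
  by apply: mulr_ge0; rewrite ?exprn_ge0 ?M0.
have [n hn] := L_div (4 * x + \sum_(i < N) (L i)^-1).
have invL0 i : 0 <= (L i)^-1 by rewrite invr_ge0 ltW.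
(* The steps lead from level [N + K] down to [N], so the first [N] inverses are discarded. *)
have [K hK] : exists K, 4 * x <= \sum_(i < K) (L (N + i)%N)^-1.
  exists n; rewrite -(lerD2r (\sum_(i < N) (L i)^-1)) (le_trans hn)//.
  have -> : \sum_(i < n) (L (N + i)%N)^-1 + \sum_(i < N) (L i)^-1
      = \sum_(i < N + n) (L i)^-1 by rewrite big_split_ord/= addrC.
  by rewrite addnC big_split_ord/= lerDl sumr_ge0.
set S := \sum_(i < K) _ in hK.
(* [S <= 0] forces [x = 0]; otherwise division by [S] is legitimate. *)
have [S0|S0] := leP S 0.
  have -> : x = 0 by lra.
  exact: ctrl0.
(* The steps are proportional to the inverses of [L], taken from the highest level down; the ratio
   [x / S <= 1 / 4] makes them admissible and their total equal to [x]. *)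
have walk k : (k <= K)%N -> ctrl (N + (K - k)) (\sum_(i < k) x / S * (L (N + (K - i.+1))%N)^-1).
  elim: k => [|k IH] kK; first by rewrite big_ord0; exact: ctrl0.
  rewrite big_ord_recr/=; apply: ctrl_step.
  - by rewrite sumr_ge0// => i _; rewrite !mulr_ge0// invr_ge0 ltW.
  - by rewrite !mulr_ge0// invr_ge0 ltW.
  - move: (L0 (N + (K - k.+1))); set l := L _ => l0.
    have -> : x / S * l^-1 * (4 * l) = 4 * x / S.
      by field; rewrite !gt_eqF.
    by rewrite ler_pdivrMr// mul1r.
  - by rewrite -addnS -subSn// subSS; apply: IH; exact: ltnW.
have := walk K (leqnn K); rewrite subnn addn0 -mulr_sumr.
suff -> : \sum_(i < K) (L (N + (K - i.+1)))^-1 = S by rewrite divfK ?gt_eqF.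
by rewrite /S (reindex_inj rev_ord_inj)/=; apply: eq_bigr => i _; rewrite subnSK// subKn// ltnW.
Qed.

End bang.

(** * The cosine transform of a nonnegative variable and its derivatives *)

Section cosine_moments.
Context d (T : measurableType d) (R : realType) (P : probability T R).
Variables (X : T -> R) (B : nat -> R).
Hypothesis mX : measurable_fun setT X.
Hypothesis X0 : forall t, 0 <= X t.
Hypothesis momX : forall n, (\int[P]_t (X t ^+ n)%:E <= (B n)%:E)%E.

Lemma integrable_expn n : P.-integrable setT (EFin \o (fun t => X t ^+ n)).
Proof.
apply/integrableP; split.
  by apply/measurable_EFinP; exact: measurable_funX.
under eq_integral do rewrite /= ger0_norm ?exprn_ge0//.
exact: le_lt_trans (momX n) (ltry _).
Qed.

Lemma Rintegral_expn_le n : \int[P]_t (X t ^+ n) <= B n.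
Proof. by rewrite -lee_fin fineK// integrable_fin_num// integrable_expn. Qed.

(** The [n]-th derivative of [s |-> E cos (s X)], written directly as an expectation, so that
    nothing is differentiated under the integral. *)
Definition cosmom n s : R := \int[P]_t (X t ^+ n * dcos n (s * X t)).

Lemma integrable_expn_bounded n (g : T -> R) (K : R) : measurable_fun setT g ->
  (forall t, `|g t| <= K) ->
  P.-integrable setT (EFin \o (fun t => X t ^+ n * g t)).
Proof.
move=> mg gK; apply: (@le_integrable _ _ _ _ _ _ _
    (EFin \o (fun t => K * X t ^+ n))) => //.
- by apply/measurable_EFinP; apply: measurable_funM => //; exact: measurable_funX.
- move=> t _; rewrite /= lee_fin !normrM mulrC.
  apply: ler_pM => //; exact: (le_trans (gK t) (ler_norm _)).
- exact: (integrableZl _ _ (integrable_expn n)).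
Qed.

Lemma measurable_dcos n (g : T -> R) : measurable_fun setT g ->
  measurable_fun setT (fun t => dcos n (g t)).
Proof.
move=> mg; have mc : measurable_fun setT (@cos R).
  by apply: continuous_measurable_fun; exact: continuous_cos.
exact: (measurableT_comp mc (measurable_funD mg (measurable_cst _))).
Qed.

Let int_dcos n k s :
  P.-integrable setT (EFin \o (fun t => X t ^+ n * dcos k (s * X t))).
Proof.
apply: (@integrable_expn_bounded n _ 1); last by move=> t; exact: normr_dcos_le1.
by apply: measurable_dcos; exact: measurable_funM.
Qed.

(** The bound [dcos_taylor] with increment [h * X t], multiplied by [X t ^ n], is integrated; the
    remainder becomes the moment of order [n + m]. *)
Lemma cosmom_taylor n m s h : 0 <= h ->
  `|cosmom n (s + h) - \sum_(j < m) cosmom (n + j) s * h ^+ j / j`!%:R|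
    <= B (n + m) * h ^+ m.
Proof.
move=> h0.
pose G m t := X t ^+ n * dcos n ((s + h) * X t)
  - \sum_(j < m) X t ^+ (n + j) * dcos (n + j) (s * X t) * (h ^+ j / j`!%:R).
(* Linearity of the integral asks for integrability at each stage, so the induction carries both. *)
have GE k : P.-integrable setT (EFin \o G k) /\ \int[P]_t G k t =
    cosmom n (s + h) - \sum_(j < k) cosmom (n + j) s * h ^+ j / j`!%:R.
  elim: k => [|k [iG IH]].
    rewrite big_ord0 subr0; split.
      apply: eq_integrable (int_dcos n n (s + h)) => // t _.
      by rewrite /G /= big_ord0 subr0.
    by apply: eq_Rintegral => t _; rewrite /G big_ord0 subr0.
  have iH : P.-integrable setT (EFin \o (fun t =>
      X t ^+ (n + k) * dcos (n + k) (s * X t) * (h ^+ k / k`!%:R))).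
    exact: integrableZr (int_dcos _ _ _).
  have GS t : G k.+1 t = G k t
      - X t ^+ (n + k) * dcos (n + k) (s * X t) * (h ^+ k / k`!%:R).
    by rewrite /G big_ord_recr/= opprD addrA.
  split.
    apply: eq_integrable (integrableB _ iG iH) => // t _.
    by rewrite /= GS EFinB.
  under eq_Rintegral do rewrite GS.
  rewrite RintegralB// IH RintegralZr// big_ord_recr/= opprD addrA.
  by rewrite mulrA.
have [iG <-] := GE m.
apply: (le_trans (le_normr_Rintegral _ iG)) => //.
apply: (@le_trans _ _ (\int[P]_t (X t ^+ (n + m) * h ^+ m))); last first.
  rewrite RintegralZr//; last exact: integrable_expn.
  by rewrite ler_wpM2r ?exprn_ge0// Rintegral_expn_le.
apply: le_Rintegral => //.
- exact: (integrable_norm iG).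
- exact: integrableZr (integrable_expn _).
move=> t _; rewrite /G.
have -> : \sum_(j < m) X t ^+ (n + j) * dcos (n + j) (s * X t) * (h ^+ j / j`!%:R)
  = X t ^+ n * \sum_(j < m) dcos (n + j) (s * X t) * (h * X t) ^+ j / j`!%:R.
  rewrite mulr_sumr; apply: eq_bigr => j _; rewrite exprD exprMn.
  by move: (_ ^-1) => u; ring.
rewrite -mulrBr normrM ger0_norm ?exprn_ge0// exprD -mulrA -exprMn mulrC.
rewrite [X t * h]mulrC mulrC ler_wpM2l ?exprn_ge0// mulrDl.
by apply: dcos_taylor; rewrite mulr_ge0.
Qed.

Lemma cosmom_at0 n : cosmom n 0 = dcos n 0 * \int[P]_t (X t ^+ n).
Proof.
rewrite -RintegralZl//; last exact: integrable_expn.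
by apply: eq_Rintegral => t _; rewrite mul0r mulrC.
Qed.

End cosine_moments.

(** * Even moments determine the cosine transform *)

Section even_moments.
Context (R : realType) (N : nat -> R) (C : R).
Hypothesis C0 : 0 <= C.
Hypothesis N0 : forall n, 0 < N n.
Hypothesis N_nd : {homo N : m n / (m <= n)%N >-> m <= n}.
Hypothesis N_div : forall K : R, exists n, K <= \sum_(i < n) (N i)^-1.

Lemma prod_half_double j :
  \prod_(i < j.*2) N i./2 = \prod_(i < j) N i ^+ 2.
Proof.
elim: j => [|j IH]; first by rewrite !big_ord0.
by rewrite doubleS !big_ord_recr/= IH uphalf_double doubleK -mulrA expr2.
Qed.

(** The sequence [N i./2] takes each [N i] twice, which turns the hypothesis into the case of even
    [n]. An odd moment is interpolated between its two even neighbours; with weight [N j] both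
    halves of the interpolation contribute equally. *)
Lemma moment_le_prod d (T : measurableType d) (P : probability T R)
    (X : T -> R) :
  measurable_fun setT X -> (forall t, 0 <= X t) ->
  (forall j, \int[P]_t (X t ^+ j.*2)%:E <= (C * \prod_(i < j) N i ^+ 2)%:E)%E ->
  forall n, (\int[P]_t (X t ^+ n)%:E <= (C * \prod_(i < n) N i./2)%:E)%E.
Proof.
move=> mX X0 mom n; rewrite -(odd_double_half n); set j := n./2.
case: (odd n); rewrite ?add0n ?add1n; last by rewrite prod_half_double; exact: mom.
rewrite big_ord_recr/= doubleK prod_half_double.
have t0 := N0 j; set t := N j in t0 *.
have mXn k : measurable_fun setT (EFin \o (fun x => X x ^+ k)).
  by apply/measurable_EFinP; exact: measurable_funX.
(* AM-GM: [X^(2j+1) <= (t X^(2j) + X^(2j+2) / t) / 2] *)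
apply: (@le_trans _ _ (\int[P]_x ((t / 2)%:E * (X x ^+ j.*2)%:E
    + (t^-1 / 2)%:E * (X x ^+ j.+1.*2)%:E))%E).
  apply: ge0_le_integral => //.
  - by move=> x _; rewrite lee_fin exprn_ge0.
  - exact: mXn.
  - apply: emeasurable_funD; apply: measurable_funeM; exact: mXn.
  - move=> x _; rewrite -!EFinM -EFinD lee_fin doubleS !exprS.
    have Xj := exprn_ge0 j.*2 (X0 x).
    move: (X x) (X x ^+ _) Xj => a b b0.
    rewrite -subr_ge0.
    have -> : t / 2 * b + t^-1 / 2 * (a * (a * b)) - a * b
        = b * (t^-1 / 2) * (t - a) ^+ 2 by field; rewrite gt_eqF.
    apply: mulr_ge0; last exact: sqr_ge0.
    by apply: mulr_ge0 => //; rewrite divr_ge0// invr_ge0 ltW.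
rewrite ge0_integralD//; first last.
- by apply: measurable_funeM; exact: mXn.
- move=> x _; rewrite -EFinM lee_fin; apply: mulr_ge0; rewrite ?exprn_ge0//.
  by rewrite divr_ge0// invr_ge0 ltW.
- by apply: measurable_funeM; exact: mXn.
- move=> x _; rewrite -EFinM lee_fin; apply: mulr_ge0; rewrite ?exprn_ge0//.
  by rewrite divr_ge0// ltW.
rewrite !ge0_integralZl//; first last.
- by rewrite lee_fin divr_ge0// ltW.
- by move=> x _; rewrite lee_fin exprn_ge0.
- exact: mXn.
- by rewrite lee_fin divr_ge0// invr_ge0 ltW.
- by move=> x _; rewrite lee_fin exprn_ge0.
- exact: mXn.
apply: (@le_trans _ _ ((t / 2)%:E * (C * \prod_(i < j) N i ^+ 2)%:E
   + (t^-1 / 2)%:E * (C * \prod_(i < j.+1) N i ^+ 2)%:E)%E).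
  apply: leeD; apply: lee_wpmul2l => //.
  - by rewrite lee_fin divr_ge0// ltW.
  - by rewrite lee_fin divr_ge0// invr_ge0 ltW.
rewrite -!EFinM -EFinD lee_fin big_ord_recr/= -/t le_eqVlt; apply/orP; left.
by apply/eqP; field; rewrite gt_eqF.
Qed.

(** [bang_vanish] is applied to the difference of the two transforms. Its derivatives at [0] vanish:
    those of odd order because [dcos n 0 = 0], those of even order because the even moments
    agree. *)
Lemma eq_cos_transform d1 d2 (T1 : measurableType d1) (T2 : measurableType d2)
    (P1 : probability T1 R) (P2 : probability T2 R)
    (X1 : T1 -> R) (X2 : T2 -> R) :
  measurable_fun setT X1 -> measurable_fun setT X2 ->
  (forall t, 0 <= X1 t) -> (forall t, 0 <= X2 t) ->
  (forall j, \int[P1]_t (X1 t ^+ j.*2)%:E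
     <= (C * \prod_(i < j) N i ^+ 2)%:E)%E ->
  (forall j, \int[P1]_t (X1 t ^+ j.*2)%:E
     = \int[P2]_t (X2 t ^+ j.*2)%:E)%E ->
  forall s : R, 0 <= s -> \int[P1]_t cos (s * X1 t) = \int[P2]_t cos (s * X2 t).
Proof.
move=> mX1 mX2 X10 X20 mom1 mom12 s s0.
have mom2 j : (\int[P2]_t (X2 t ^+ j.*2)%:E
     <= (C * \prod_(i < j) N i ^+ 2)%:E)%E by rewrite -mom12.
have B1 := moment_le_prod mX1 X10 mom1.
have B2 := moment_le_prod mX2 X20 mom2.
have E (u : R) d' (T' : measurableType d') (Q : probability T' R) (Z : T' -> R) :
    \int[Q]_t cos (u * Z t) = cosmom Q Z 0 u.
  by apply: eq_Rintegral => t _; rewrite expr0 mul1r dcos0.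
rewrite !E; apply/eqP; rewrite -subr_eq0; apply/eqP.
(* The constant doubles because the Taylor errors of the two transforms add up. *)
apply: (@bang_vanish R (fun n x => cosmom P1 X1 n x - cosmom P2 X2 n x)
  (C * 2) (fun i => N i./2)) => //.
- by rewrite mulr_ge0.
- by move=> m n mn; apply: N_nd; exact: half_leq.
- move=> K; have [n Kn] := N_div K; exists n; apply: (le_trans Kn).
  apply: ler_sum => i _; rewrite lef_pV2 ?posrE//; apply: N_nd.
  by rewrite -[leqRHS]doubleK half_leq// -addnn leq_addr.
- move=> n m x h x0 h0.
  have h1 := cosmom_taylor mX1 X10 B1 n m x h0.
  have h2 := cosmom_taylor mX2 X20 B2 n m x h0.
  under eq_bigr do rewrite !mulrBl.
  rewrite sumrB; set a := cosmom P1 _ _ _ in h1 *; set b := cosmom P2 _ _ _ in h2 *.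
  set u := \sum_(i < m) _ in h1 *; set v := \sum_(i < m) _ in h2 *.
  have -> : a - b - (u - v) = (a - u) - (b - v) by ring.
  apply: (le_trans (ler_normB _ _)); apply: (le_trans (lerD h1 h2)).
  by rewrite le_eqVlt; apply/orP; left; apply/eqP; ring.
- move=> n; rewrite (cosmom_at0 mX1 X10 B1) (cosmom_at0 mX2 X20 B2).
  have [on|en] := boolP (odd n); first by rewrite dcos_odd0// !mul0r subrr.
  by rewrite /Rintegral -(even_halfK en) mom12 subrr.
Qed.

End even_moments.

(** * Finite trigonometric sums *)

Section discrete_cosine.
Variable R : realType.
Implicit Types (x : R) (m n K : nat).

Lemma cosD2pin x n : cos (x + pi *+ 2 *+ n) = cos x.
Proof. exact: (periodicn (@cosD2pi R)). Qed.

(** With [r] the fractional part of [x], either [2 pi r] or [2 pi (1 - r)] lies in [[0, pi]], where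
    the cosine is injective; the second case would give [r = 1]. *)
Lemma nat_num_of_cos2pi x : 0 <= x -> cos (pi *+ 2 * x) = 1 -> x \is a Num.nat.
Proof.
move=> x0; have /andP[] := truncn_itv x0; set n := Num.truncn x => nx xn1.
have -> : x = (x - n%:R) + n%:R by rewrite subrK.
rewrite mulrDr mulr_natr cosD2pin => c1.
suff -> : x - n%:R = 0 by rewrite add0r; apply/natrP; exists n.
have r0 : 0 <= x - n%:R by rewrite subr_ge0.
have r1 : x - n%:R < 1 by rewrite ltrBlDl natr1.
move: (x - n%:R) r0 r1 c1 => r r0 r1 c1.
have pi0 := pi_gt0 R; have pi2 : pi *+ 2 = 2 * pi :> R by rewrite mulr_natl.
have tp : pi *+ 2 != 0 :> R by rewrite mulrn_eq0/= gt_eqF.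
have zero_pi : (0 : R) \in `[0, pi]%R by rewrite in_itv/= lexx ltW.
have [rh|rh] := leP r 2^-1.
- have : pi *+ 2 * r = 0.
    apply: cos_inj => //; last by rewrite c1 cos0.
    by rewrite in_itv/= pi2 -mulrA mulrCA; apply/andP; split; nra.
  by move/eqP; rewrite mulf_eq0 (negPf tp)/= => /eqP.
- have : pi *+ 2 * (1 - r) = 0.
    apply: cos_inj => //.
      by rewrite in_itv/= pi2; apply/andP; split; nra.
    by rewrite mulrBr mulr1 addrC -[pi *+ 2](mulr1n) cosD2pin cosN c1 cos0.
  move/eqP; rewrite mulf_eq0 (negPf tp)/= subr_eq0 => /eqP r1'.
  by rewrite r1' ltxx in r1.
Qed.

(** Each term becomes [sin ((j + 1/2) a) - sin ((j - 1/2) a)]. *)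
Lemma cos_sum_telescope (a : R) n :
  2 * sin (a / 2) * \sum_(j < n) cos (j%:R * a)
  = sin (n%:R * a - a / 2) + sin (a / 2).
Proof.
elim: n => [|n IH].
  by rewrite big_ord0 mulr0 mul0r sub0r sinN addNr.
rewrite big_ord_recr/= mulrDr IH.
have -> : n.+1%:R * a - a / 2 = n%:R * a + a / 2 by rewrite -natr1; field.
by rewrite sinB sinD; ring.
Qed.

(** The real part of a sum over roots of unity. For [0 < n <= K] the half-angle [a / 2] lies
    strictly between [0] and [pi], so its sine can be cancelled, and [K.+1 * a] is a multiple of
    [2 pi]. *)
Lemma cos_sum_roots K n : (n <= K)%N ->
  \sum_(j < K.+1) cos (j%:R * (pi *+ 2 * n%:R / K.+1%:R))
    = if n == 0%N then K.+1%:R else 0 :> R.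
Proof.
move=> nK; case: eqP => [->|/eqP n0].
  under eq_bigr do rewrite mulr0 mul0r mulr0 cos0.
  by rewrite big_const_ord iter_addr_0.
set a := pi *+ 2 * _ / _.
have K0 : K.+1%:R != 0 :> R by rewrite pnatr_eq0.
have s0 : sin (a / 2) != 0.
  rewrite gt_eqF// sin_gt0_pi// /a -[pi *+ 2]mulr_natr.
  have -> : pi * 2 * n%:R / K.+1%:R / 2 = pi * (n%:R / K.+1%:R) :> R by field.
  have pi0 := pi_gt0 R.
  rewrite mulr_gt0 ?divr_gt0 ?ltr0n ?lt0n//= gtr_pMr//.
  by rewrite ltr_pdivrMr ?ltr0n// mul1r ltr_nat ltnS.
have := cos_sum_telescope a K.+1.
have -> : K.+1%:R * a - a / 2 = - (a / 2) + pi *+ 2 *+ n.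
  by rewrite /a -[_ *+ n]mulr_natr; field.
rewrite (periodicn (@sinD2pi R)) sinN addNr => /eqP.
by rewrite mulf_eq0 mulf_eq0 (negbTE s0) pnatr_eq0/= => /eqP.
Qed.

(** A discrete Fourier filter for the integer [m]; as a combination of finitely many [cos (s x)], it
    has an expectation that depends only on the cosine transform. *)
Definition cosavg m K x : R :=
  K.+1%:R^-1 * \sum_(j < K.+1)
    cos (pi *+ 2 / K.+1%:R * j%:R * m%:R) * cos (pi *+ 2 / K.+1%:R * j%:R * x).

Lemma normr_cosavg_le1 m K x : `|cosavg m K x| <= 1.
Proof.
rewrite normrM ger0_norm ?invr_ge0// ler_pdivrMl ?ltr0n// mulr1.
apply: (le_trans (ler_norm_sum _ _ _)).
apply: (@le_trans _ _ (\sum_(j < K.+1) 1)); last by rewrite sumr_const card_ord.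
apply: ler_sum => j _.
by rewrite normrM mulr_ile1// ?cos_max.
Qed.

(** The product formula splits the average into sums at the frequencies [n - m] and [n + m]. Both
    contribute when [n = m = 0], only the first when [n = m > 0]; hence the values [1] and
    [1 / 2]. *)
Lemma cosavg_nat m n K : (n + m <= K)%N ->
  cosavg m K n%:R = (if n == m then (1 + (m == 0%N)%:R) / 2 else 0).
Proof.
move=> nmK; rewrite /cosavg.
have K0 : K.+1%:R != 0 :> R by rewrite pnatr_eq0.
have h (a b : R) : cos a * cos b = 2^-1 * cos (a - b) + 2^-1 * cos (a + b).
  by rewrite cosB cosD; field.
under eq_bigr do rewrite h; rewrite big_split/= -!mulr_sumr.
have S1 : \sum_(i < K.+1) cos (pi *+ 2 / K.+1%:R * i%:R * m%:R
      + pi *+ 2 / K.+1%:R * i%:R * n%:R)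
    = if (n + m == 0)%N then K.+1%:R else 0 :> R.
  rewrite -(cos_sum_roots nmK); apply: eq_bigr => i _; congr cos.
  by rewrite natrD; field.
have S2 : \sum_(i < K.+1) cos (pi *+ 2 / K.+1%:R * i%:R * m%:R
      - pi *+ 2 / K.+1%:R * i%:R * n%:R)
    = if n == m then K.+1%:R else 0 :> R.
  wlog nm : m n nmK {S1} / (n <= m)%N => [wl|].
    have [/wl->//|/ltnW mn] := leqP n m.
    rewrite eq_sym -(wl n m) 1?addnC//; apply: eq_bigr => i _.
    by rewrite -cosN opprB.
  have mnK : (m - n <= K)%N.
    by rewrite (leq_trans (leq_subr _ _))// (leq_trans _ nmK)// leq_addl.
  have := cos_sum_roots mnK; rewrite subn_eq0 eqn_leq nm/= => <-.
  by apply: eq_bigr => i _; congr cos; rewrite natrB//; field.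
rewrite S1 S2 addn_eq0; have [->|nm] := eqVneq n m; last first.
  case: (n =P 0%N) => [n0|_]; last by rewrite /= !mulr0 addr0 mulr0.
  case: (m =P 0%N) => [m0|_]; last by rewrite /= !mulr0 addr0 mulr0.
  by rewrite n0 m0 eqxx in nm.
by rewrite andbb; case: (m == 0%N); rewrite /= ?mulr0 ?addr0; field.
Qed.

End discrete_cosine.

(** * Recovering an integer-valued law from its cosine transform *)

Section law_of_nat_valued.
Variable R : realType.

Section point_mass.
Context d (T : measurableType d) (P : probability T R) (X : T -> R).
Hypothesis mX : measurable_fun setT X.

Lemma Rintegral_prob1 : \int[P]_t (cst 1 t) = 1 :> R.
Proof.
rewrite Rintegral_cst// mul1r.
by transitivity (fine (P setT)); last rewrite probability_setT.
Qed.

Lemma measurable_cosM (s : R) : measurable_fun setT (fun t => cos (s * X t)).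
Proof.
apply: (measurableT_comp (f := @cos R)).
  by apply: continuous_measurable_fun; exact: continuous_cos.
exact: measurable_funM.
Qed.

Lemma integrable_cosM (s : R) : P.-integrable setT (EFin \o (fun t => cos (s * X t))).
Proof.
apply: (@le_integrable _ _ _ _ _ _ _ (EFin \o cst 1)) => //.
- by apply/measurable_EFinP; exact: measurable_cosM.
- by move=> t _; rewrite /= lee_fin normr1 cos_max.
- exact: finite_measure_integrable_cst.
Qed.

(** [1 - cos (2 pi X)] is nonnegative with zero expectation, hence vanishes almost everywhere. *)
Lemma ae_nat_num : (forall t, 0 <= X t) ->
  \int[P]_t cos (pi *+ 2 * X t) = 1 -> {ae P, forall t, X t \is a Num.nat}.
Proof.
move=> X0 c1; have i1 := integrable_cosM (pi *+ 2).
have ic : P.-integrable setT (EFin \o cst (1 : R)).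
  exact: finite_measure_integrable_cst.
have R0 : \int[P]_t (1 - cos (pi *+ 2 * X t)) = 0.
  by rewrite RintegralB// c1 Rintegral_prob1// subrr.
have I0 : (\int[P]_t `|(1 - cos (pi *+ 2 * X t))%:E| = 0)%E.
  rewrite -[0%E]/(0%:E) -R0 fineK; last first.
    exact/integrable_fin_num/(integrableB _ ic i1).
  by apply: eq_integral => t _; rewrite abse_EFin ger0_norm// subr_ge0 cos_le1.
have mf : measurable_fun setT (fun t => (1 - cos (pi *+ 2 * X t))%:E).
  exact: (measurable_int _ (integrableB _ ic i1)).
have [ae0 _] := ae_eq_integral_abs P measurableT mf.
have := ae0 I0; apply: filterS => t /(_ I) [] /eqP.
rewrite subr_eq0 eq_sym => /eqP; exact: nat_num_of_cos2pi.
Qed.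

(** Dominated convergence with the bound [1]: at an integer value [n] of [X] the sequence is
    constant from [K = n + m] on. *)
Lemma cvg_Rintegral_cosavg m : {ae P, forall t, X t \is a Num.nat} ->
  \int[P]_t cosavg m K (X t) @[K --> \oo]
    --> (1 + (m == 0%N)%:R) / 2 * fine (P (X @^-1` [set m%:R])).
Proof.
move=> natX; set c := _ / 2.
have mXm : measurable (X @^-1` [set m%:R]).
  by rewrite -[X in measurable X]setTI; exact: mX.
have mc K : measurable_fun setT (fun t => cosavg m K (X t)).
  apply: measurable_funM => //; apply: measurable_sum => j.
  by apply: measurable_funM => //; exact: measurable_cosM.
pose f t := c * \1_(X @^-1` [set m%:R]) t.
have [] := @dominated_convergence _ _ _ P setT measurableT
  (fun K t => (cosavg m K (X t))%:E) (EFin \o f) (cst 1%E).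
- by move=> K; apply/measurable_EFinP; exact: mc.
- by apply/measurable_EFinP; apply: measurable_funM.
- apply: filterS natX => t /natrP[n Xn] _.
  apply: cvg_EFin; first exact: nearW.
  apply: cvg_near_cst; exists (n + m)%N => // K /= nmK.
  rewrite /= Xn cosavg_nat// /f indicE.
  have -> : (t \in X @^-1` [set m%:R]) = (n == m).
    by apply/idP/eqP => [|<-]; rewrite inE/= Xn => // /eqP; rewrite eqr_nat => /eqP.
  by case: eqP; rewrite ?mulr1 ?mulr0.
- exact: finite_measure_integrable_cst.
- by apply: nearW => t K _; rewrite lee_fin normr_cosavg_le1.
move=> fi _; rewrite -(fineK (integrable_fin_num _ fi))// => /fine_cvg.
suff -> : fine (\int[P]_x (f x)%:E) = c * fine (P (X @^-1` [set m%:R])) by [].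
rewrite -[LHS]/(\int[P]_x f x) RintegralZl//; last first.
  exact: integrable_indic.
by rewrite /Rintegral integral_indic// setIT.
Qed.

Lemma Rintegral_cosavg m K : \int[P]_t cosavg m K (X t) =
  K.+1%:R^-1 * \sum_(j < K.+1) cos (pi *+ 2 / K.+1%:R * j%:R * m%:R)
    * \int[P]_t cos (pi *+ 2 / K.+1%:R * j%:R * X t).
Proof.
pose g n t := \sum_(j < n) cos (pi *+ 2 / K.+1%:R * j%:R * m%:R)
  * cos (pi *+ 2 / K.+1%:R * j%:R * X t).
suff gE n : P.-integrable setT (EFin \o g n) /\ \int[P]_t g n t =
    \sum_(j < n) cos (pi *+ 2 / K.+1%:R * j%:R * m%:R)
      * \int[P]_t cos (pi *+ 2 / K.+1%:R * j%:R * X t).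
  have [ig Eg] := gE K.+1; rewrite -Eg -RintegralZl//.
elim: n => [|n [ig IH]].
  have g0 t : g 0 t = 0 by rewrite /g big_ord0.
  split; first by apply: eq_integrable (integrable0 _ _) => // t _; rewrite /= g0.
  rewrite big_ord0; under eq_Rintegral do rewrite g0.
  by rewrite /Rintegral integral0.
have gS t : g n.+1 t = g n t + cos (pi *+ 2 / K.+1%:R * n%:R * m%:R)
  * cos (pi *+ 2 / K.+1%:R * n%:R * X t) by rewrite /g big_ord_recr.
have iZ : P.-integrable setT (EFin \o (fun t =>
    cos (pi *+ 2 / K.+1%:R * n%:R * m%:R) * cos (pi *+ 2 / K.+1%:R * n%:R * X t))).
  exact: integrableZl (integrable_cosM _).
split.
  by apply: eq_integrable (integrableD _ ig iZ) => // t _; rewrite /= gS EFinD.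
under eq_Rintegral do rewrite gS.
by rewrite RintegralD// IH RintegralZl ?big_ord_recr//; exact: integrable_cosM.
Qed.

(** Outside the null set [Z] the preimage of [B] is the disjoint union of the [V n], each of which
    is a full fibre or empty according to whether [n] lies in [B]. *)
Lemma nat_valued_law (B : set R) : {ae P, forall t, X t \is a Num.nat} ->
  measurable B ->
  P (X @^-1` B) = (\sum_(0 <= n <oo | n%:R \in B) P (X @^-1` [set n%:R]))%E.
Proof.
move=> [Z [mZ PZ0 subZ]] mB.
have mXA A : measurable A -> measurable (X @^-1` A).
  by move=> mA; rewrite -[X in measurable X]setTI; exact: mX.
pose V n : set T := X @^-1` (B `&` [set n%:R]).
have mV n : measurable (V n) by apply: mXA; exact: measurableI.
have tV : trivIset setT V.
  apply/trivIsetP => i j _ _ ij; rewrite -subset0 => t [[_ /= Xi] [_ /= Xj]].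
  by move/eqP: Xj; rewrite Xi eqr_nat (negbTE ij).
transitivity (P (\bigcup_n V n)).
  apply/eqP; rewrite eq_le; apply/andP; split; last first.
    apply: le_measure; rewrite ?inE; [exact: bigcup_measurable|exact: mXA|].
    by move=> t [n _] [].
  have -> : P (\bigcup_n V n) = (P (\bigcup_n V n) + P Z)%E by rewrite PZ0 adde0.
  apply: le_trans (measureU2 _ _ _) => //; last exact: bigcup_measurable.
  apply: le_measure; rewrite ?inE; first exact: mXA.
    by apply: measurableU => //; exact: bigcup_measurable.
  move=> t Bt; have [/natrP[n Xn]|nX] := pselect (X t \is a Num.nat).
    by left; exists n => //; split.
  by right; apply: subZ.
rewrite measure_bigcup//= eseries_mkcond [RHS]eseries_mkcond; apply: eq_eseriesr => n _.
rewrite in_setT.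
rewrite /V; case: ifPn; rewrite ?inE ?notin_setE => Bn.
  by congr (P _); apply/seteqP; split => [t []//|t Xt]; rewrite /preimage/= Xt.
rewrite (_ : X @^-1` _ = set0) ?measure0// -subset0 => t [] /=.
by move=> + Xt; rewrite Xt.
Qed.

End point_mass.

(** Integrality passes from [X1] to [X2] through the value at [s = 2 pi]. The expectations of
    [cosavg] then agree for every [K], and so do their limits, which are the point masses up to a
    common nonzero factor. *)
Lemma eq_law_of_cos d1 d2 (T1 : measurableType d1) (T2 : measurableType d2)
    (P1 : probability T1 R) (P2 : probability T2 R)
    (X1 : T1 -> R) (X2 : T2 -> R) :
  measurable_fun setT X1 -> measurable_fun setT X2 ->
  (forall t, X1 t \is a Num.nat) -> (forall t, 0 <= X2 t) ->
  (forall s : R, 0 <= s ->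
     \int[P1]_t cos (s * X1 t) = \int[P2]_t cos (s * X2 t)) ->
  forall B : set R, measurable B -> P1 (X1 @^-1` B) = P2 (X2 @^-1` B).
Proof.
move=> mX1 mX2 X1n X20 Ecos B mB.
have p0 : 0 <= pi *+ 2 :> R by apply: mulrn_wge0; exact: pi_ge0.
have aX1 : {ae P1, forall t, X1 t \is a Num.nat} by exact: aeW.
have aX2 : {ae P2, forall t, X2 t \is a Num.nat}.
  apply: ae_nat_num => //; rewrite -Ecos//.
  have -> : \int[P1]_t cos (pi *+ 2 * X1 t) = \int[P1]_t (cst 1 t).
    apply: eq_Rintegral => t _; have /natrP[n ->] := X1n t.
    by rewrite mulr_natr -[X in cos X]add0r cosD2pin cos0.
  exact: Rintegral_prob1.
rewrite (nat_valued_law mX1 aX1 mB) (nat_valued_law mX2 aX2 mB).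
apply: eq_eseriesr => m _.
have mX d (T : measurableType d) (X : T -> R) : measurable_fun setT X ->
    measurable (X @^-1` [set m%:R]).
  by move=> mX; rewrite -[X in measurable X]setTI; exact: mX.
rewrite -[RHS]fineK ?fin_num_measure//; last exact: mX.
rewrite -[LHS]fineK ?fin_num_measure//; last exact: mX.
congr EFin.
have := cvg_Rintegral_cosavg mX1 (m := m) aX1.
have := cvg_Rintegral_cosavg mX2 (m := m) aX2.
have -> : (fun K => \int[P2]_t cosavg m K (X2 t))
    = (fun K => \int[P1]_t cosavg m K (X1 t)).
  apply/funext => K; rewrite !Rintegral_cosavg//; congr (_ * _).
  apply: eq_bigr => j _; rewrite Ecos//.
  by rewrite mulr_ge0// divr_ge0.
move=> c2 c1; have := cvg_unique (@Rhausdorff R) c1 c2 => /(_ _)/mulfI; apply.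
by rewrite mulf_neq0 ?invr_eq0//; case: (m == 0%N); rewrite /= gt_eqF.
Qed.

End law_of_nat_valued.

(** * Tails of the series of inverse squares *)

Section sums_of_inverse_squares.
Variable R : realType.

Lemma nneseries_le_fin (u : nat -> R) n0 (B : R) :
  (forall n, (n0 <= n)%N -> 0 <= u n) ->
  (forall m, \sum_(n0 <= n < m) u n <= B) ->
  (\sum_(n0 <= n <oo) (u n)%:E <= B%:E)%E.
Proof.
move=> u0 uB; apply: lime_le.
  by apply: is_cvg_nneseries => n nn _; rewrite lee_fin u0.
by apply: nearW => m; rewrite sumEFin lee_fin.
Qed.

(** [1 / n^2 <= 1 / (n - 1) - 1 / n] telescopes to at most [1 / (N - 1)], which is at most [2 / N].
    The indicator gives all tails the same range, ready for an exchange of sums. *)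
Lemma sum_inv_sq_le N m : (2 <= N)%N ->
  \sum_(0 <= n < m) (N <= n)%:R / n%:R ^+ 2 <= 2 / N%:R :> R.
Proof.
move=> N2.
have N0 : 2 <= N%:R :> R by rewrite ler_nat.
have inv (x : R) : 2 <= x -> (x - 1)^-1 <= 2 / x.
  move=> x2; rewrite -subr_ge0.
  have x0 : x != 0 by rewrite gt_eqF//; lra.
  have x1 : x - 1 != 0 by rewrite gt_eqF//; lra.
  have -> : 2 / x - (x - 1)^-1 = (x - 2) / (x * (x - 1)) by field; rewrite x0 x1.
  by apply: divr_ge0; [lra|apply: mulr_ge0; lra].
have [mN|Nm] := leqP m N.
  rewrite big_nat_cond big1 ?divr_ge0// => n /andP[/andP[_ nm] _].
  by rewrite leqNgt (leq_trans nm mN) mul0r.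
apply: le_trans (inv _ N0); rewrite -subr_ge0.
have m1 : 0 <= (m%:R - 1)^-1 :> R.
  by rewrite invr_ge0 subr_ge0 ler1n (leq_ltn_trans (leq0n N) Nm).
suff h : \sum_(0 <= n < m) (N <= n)%:R / n%:R ^+ 2
    <= (N%:R - 1)^-1 - (m%:R - 1)^-1 :> R.
  by rewrite subr_ge0 (le_trans h)// gerBl.
elim: m Nm {m1} => // m IH; rewrite ltnS => Nm; rewrite big_nat_recr//= Nm mul1r.
have m2 : 2 <= m%:R :> R by rewrite ler_nat (leq_trans N2).
have step : (m%:R ^+ 2)^-1 <= (m%:R - 1)^-1 - (m.+1%:R - 1)^-1 :> R.
  rewrite -natr1 addrK -subr_ge0; move: (m%:R) m2 => x x2.
  have -> : (x - 1)^-1 - x^-1 - (x ^+ 2)^-1 = ((x - 1) * x ^+ 2)^-1.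
    have x0 : x != 0 by rewrite gt_eqF//; lra.
    have x1 : x - 1 != 0 by rewrite gt_eqF//; lra.
    by field; rewrite x0 x1.
  by rewrite invr_ge0 mulr_ge0 ?sqr_ge0//; lra.
move: Nm; rewrite leq_eqVlt => /predU1P[Nm|Nm].
  rewrite big_nat_cond big1 ?add0r; first by rewrite [X in (X%:R - 1)^-1]Nm.
  by move=> n /andP[/andP[_ nm] _]; rewrite Nm leqNgt nm mul0r.
by have := IH Nm; lra.
Qed.

End sums_of_inverse_squares.

(** * The growth sequence extracted from the point masses *)

Section growth_sequence.
Variables (R : realType) (p : nat -> R) (n0 : nat) (C : R).
Hypothesis p_gt0 : forall n, 0 < p n.
Hypothesis p_le1 : forall n, p n <= 1.
Hypothesis n0_ge2 : (2 <= n0)%N.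
Hypothesis C2 : 2 <= C.
Hypothesis p_sq : forall n, n%:R ^+ 2 * p n <= C.

Let a n : R := - ln (2^-1 * p n) / ln n%:R.

Hypothesis p_div : (\sum_(n0 <= n <oo)
  (- ln (p n) / (n%:R ^+ 2 * ln n%:R))%:E = +oo)%E.
Hypothesis a_nd : forall m n, (n0 <= m)%N -> (m <= n)%N -> a m <= a n.
Hypothesis a_lim : a n @[n --> \oo] --> +oo.

Let ln_n n : (n0 <= n)%N -> 0 < ln n%:R :> R.
Proof. by move=> nn; rewrite ln_gt0// ltr1n (leq_trans n0_ge2). Qed.

Let exN j : exists n, (n0 <= n)%N && ((2 * j + 4)%:R < a n).
Proof.
have /cvgryPgt/(_ (2 * j + 4)%:R) [m _ hm] := a_lim.
exists (maxn n0 m); rewrite leq_maxl/=; apply: hm => /=; exact: leq_maxr.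
Qed.

(** [2 j + 4] is the exponent in [pow_p_le] at [j.+1]: the moment order [2 (j + 1)] plus two powers
    kept for summability in [n]. *)
Definition threshold j := ex_minn (exN j).

Let threshold_ge j : (n0 <= threshold j)%N.
Proof. by rewrite /threshold; case: ex_minnP => n /andP[]. Qed.

Let threshold_gt j n : (threshold j <= n)%N -> (2 * j + 4)%:R < a n.
Proof.
rewrite /threshold; case: ex_minnP => m /andP[nm am] _ mn.
exact: lt_le_trans am (a_nd nm mn).
Qed.

Let threshold_le j n : (n0 <= n)%N -> (2 * j + 4)%:R < a n -> (threshold j <= n)%N.
Proof.
by move=> nn an; rewrite /threshold; case: ex_minnP => m _; apply; rewrite nn.
Qed.

Lemma threshold_nd i j : (i <= j)%N -> (threshold i <= threshold j)%N.
Proof.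
move=> ij; apply: threshold_le => //; apply: le_lt_trans (threshold_gt (leqnn _)).
by rewrite ler_nat leq_add2r leq_mul2l.
Qed.

(** [k < a n] means [n^k * (p n / 2) < 1]; the bound [2] stems from the factor [1 / 2] inside
    [a]. *)
Let pow_mul_p n k : (n0 <= n)%N -> k%:R < a n -> n%:R ^+ k * p n <= 2.
Proof.
move=> nn; rewrite /a ltr_pdivlMr ?ln_n// => h.
have np : 0 < n%:R :> R by rewrite ltr0n (leq_trans _ (leq_trans n0_ge2 nn)).
have q0 : 0 < 2^-1 * p n by rewrite mulr_gt0.
rewrite leNgt; apply/negP => lt2.
have : 0 < ln (n%:R ^+ k * (2^-1 * p n)).
  by rewrite ln_gt0// mulrCA ltr_pdivlMl// mulr1.
rewrite lnM ?posrE ?exprn_gt0// lnXn// -[_ *+ k]mulr_natl; lra.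
Qed.

Lemma pow_p_le j n : n%:R ^+ j.+1.*2 * p n
  <= C * \prod_(i < j) (threshold i)%:R ^+ 2.
Proof.
elim: j => [|j IH]; first by rewrite big_ord0 mulr1; exact: p_sq.
have prod1 k : 1 <= \prod_(i < k) (threshold i)%:R ^+ 2 :> R.
  elim: k => [|k IHk]; first by rewrite big_ord0.
  rewrite big_ord_recr/=; apply: mulr_ege1 => //; apply: exprn_ege1.
  by rewrite ler1n (leq_trans _ (threshold_ge k))// (leq_trans _ n0_ge2).
have [nj|jn] := leqP n (threshold j).
  rewrite doubleS -addn2 exprD mulrAC big_ord_recr/= mulrA; apply: ler_pM => //.
  - by rewrite mulr_ge0 ?exprn_ge0// ltW.
  - by rewrite lerXn2r ?nnegrE// ler_nat.
apply: (@le_trans _ _ 2).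
  apply: pow_mul_p; first exact: leq_trans (threshold_ge j) (ltnW jn).
  have -> : j.+2.*2 = (2 * j + 4)%N by rewrite mul2n !doubleS !addnS addn0.
  exact: threshold_gt (ltnW jn).
apply: (le_trans C2); rewrite ler_peMr// (le_trans _ C2)//.
Qed.

(** By contradiction. [a n] is at most [4] plus twice the number of thresholds up to [n]. Dividing
    by [n^2] and exchanging sums bounds the series by [4 * 1 + 2 * (2 * K)], each threshold
    contributing a tail of inverse squares. *)
Lemma threshold_div (K : R) : exists n, K <= \sum_(i < n) ((threshold i)%:R : R)^-1.
Proof.
apply: contrapT => /forallNP hK.
have ub n : \sum_(i < n) ((threshold i)%:R : R)^-1 <= K.
  by rewrite leNgt; apply/negP => /ltW; exact: hK.
suff : (\sum_(n0 <= n <oo) (- ln (p n) / (n%:R ^+ 2 * ln n%:R))%:E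
    <= (4 + 4 * K)%:E)%E by rewrite p_div leye_eq.
apply: nneseries_le_fin => [n nn|m].
  rewrite divr_ge0 ?mulr_ge0 ?exprn_ge0// ?(ltW (ln_n nn))//.
  by rewrite oppr_ge0 ln_le0.
(* For a fixed [m], finitely many thresholds suffice to count against all the [a n] with [n < m]. *)
have [I hI] : exists I : nat, forall n, (n0 <= n < m)%N -> a n <= (2 * I + 4)%:R.
  exists (Num.truncn (a m)).+1 => n /andP[nn nm].
  apply: (le_trans (a_nd nn (ltnW nm))); apply: (le_trans (ltW (truncnS_gt _))).
  by rewrite ler_nat mul2n -addnn -addnA leq_addr.
(* If [a n] exceeds [2 k + 4], the thresholds of index [0] to [k] are all at most [n], and the sum
   is exactly [k.+1]. *)
have count n k : (n0 <= n)%N -> a n <= (2 * k + 4)%:R ->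
    a n <= 4 + 2 * \sum_(i < k) (threshold i <= n)%:R.
  move=> nn; elim: k => [|k IHk] ak.
    by rewrite big_ord0 mulr0 addr0 (le_trans ak).
  have [ank|ank] := leP (a n) (2 * k + 4)%:R.
    by rewrite (le_trans (IHk ank))// big_ord_recr/= lerD2l ler_pM2l// lerDl.
  rewrite (le_trans ak)//; have -> : \sum_(i < k.+1) (threshold i <= n)%:R = k.+1%:R :> R.
    rewrite -[in RHS](card_ord k.+1) -sumr_const; apply: eq_bigr => i _.
    by rewrite (leq_trans (threshold_nd _) (threshold_le nn ank))// -ltnS.
  by rewrite natrD natrM addrC.
apply: (@le_trans _ _ (\sum_(n0 <= n < m) (4 * ((2 <= n)%:R / n%:R ^+ 2)
    + 2 * \sum_(i < I) (threshold i <= n)%:R / n%:R ^+ 2))).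
  rewrite !big_nat; apply: ler_sum => n nm; have /andP[nn _] := nm.
  have n2 : (2 <= n)%N by exact: leq_trans nn.
  have np : 0 < n%:R :> R by rewrite ltr0n (leq_trans _ n2).
  rewrite n2 -mulr_suml mul1r mulrA -mulrDl invfM mulrA mulrAC.
  rewrite ler_wpM2r ?invr_ge0 ?exprn_ge0//.
  apply: le_trans (count n I nn (hI n nm)).
  rewrite /a ler_wpM2r ?invr_ge0 ?(ltW (ln_n nn))// lerN2 ler_ln ?posrE ?mulr_gt0//.
  by rewrite ler_piMl ?(ltW (p_gt0 _))//; lra.
have widen (F : nat -> R) : (forall n, 0 <= F n) ->
    \sum_(n0 <= n < m) F n <= \sum_(0 <= n < m) F n.
  move=> F0; have [n0m|mn0] := leqP n0 m.
    by rewrite (big_cat_nat (n := n0) (m := 0%N) (p := m))//= lerDr sumr_ge0.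
  by rewrite big_geq ?(ltnW mn0)// sumr_ge0.
have qF (b : bool) n : 0 <= b%:R / n%:R ^+ 2 :> R by rewrite divr_ge0 ?exprn_ge0.
rewrite big_split/= -!mulr_sumr lerD//.
  have := sum_inv_sq_le R m (leqnn 2); have := widen (fun n => (2 <= n)%:R / n%:R ^+ 2) (fun n => qF _ n).
  lra.
have : \sum_(n0 <= n < m) \sum_(i < I) (threshold i <= n)%:R / n%:R ^+ 2
    <= 2 * \sum_(i < I) ((threshold i)%:R : R)^-1.
  rewrite exchange_big/= mulr_sumr; apply: ler_sum => i _.
  apply: (le_trans (widen _ (fun n => qF _ n))); apply: sum_inv_sq_le.
  exact: leq_trans (threshold_ge i).
have := ub I; lra.
Qed.

Lemma exists_growth_sequence : exists N : nat -> R,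
  [/\ forall j, 1 <= N j,
      {homo N : i j / (i <= j)%N >-> i <= j},
      forall K : R, exists n, K <= \sum_(i < n) (N i)^-1 &
      forall j n, n%:R ^+ j.+1.*2 * p n <= C * \prod_(i < j) N i ^+ 2].
Proof.
exists (fun j => (threshold j)%:R); split.
- by move=> j; rewrite ler1n (leq_trans _ (threshold_ge j))// (leq_trans _ n0_ge2).
- by move=> i j ij; rewrite ler_nat threshold_nd.
- exact: threshold_div.
- exact: pow_p_le.
Qed.

End growth_sequence.

(** * Moment bounds and Carleman's condition *)

Section nat_valued_moments.
Context d (T : measurableType d) (R : realType) (P : probability T R).
Variable X : T -> R.
Hypothesis mX : measurable_fun setT X.
Hypothesis natX : forall t, X t \is a Num.nat.

Let p n := fine (P (X @^-1` [set n%:R])).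

Lemma moment_series k :
  (\int[P]_t (X t ^+ k)%:E = \sum_(0 <= n <oo) (n%:R ^+ k * p n)%:E)%E.
Proof.
pose F n := X @^-1` [set n%:R].
have mF n : measurable (F n) by rewrite -[F n]setTI; exact: mX.
have -> : [set: T] = \bigcup_n F n.
  apply/seteqP; split => // t _; have /natrP[n Xn] := natX t.
  by exists n.
rewrite ge0_integral_bigcup//.
- apply: eq_eseriesr => n _.
  rewrite (eq_integral (cst (n%:R ^+ k)%:E)); last first.
    by move=> t; rewrite inE /F/= => ->.
  by rewrite integral_cst// EFinM /p fineK// fin_num_measure//; exact: mF.
- apply/measurable_EFinP; apply: measurable_funS (measurable_funX k mX) => //.
- by move=> t _; rewrite lee_fin; have /natrP[n ->] := natX t; rewrite exprn_ge0.
- apply/trivIsetP => i j _ _ ij; rewrite -subset0 => t [/= Xi Xj].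
  by move/eqP: Xj; rewrite Xi eqr_nat (negbTE ij).
Qed.

Lemma point_mass_ge0 n : 0 <= p n.
Proof. exact: fine_ge0. Qed.

Lemma point_mass_le1 n : p n <= 1.
Proof.
have mXn : measurable (X @^-1` [set n%:R]).
  by rewrite -[X in measurable X]setTI; exact: mX.
by rewrite -lee_fin fineK ?fin_num_measure// probability_le1.
Qed.

Lemma term_le_moment k n : ((n%:R ^+ k * p n)%:E <= \int[P]_t (X t ^+ k)%:E)%E.
Proof.
rewrite moment_series.
have u0 m : (0 <= m)%N -> true -> (0 <= (m%:R ^+ k * p m)%:E)%E.
  by move=> _ _; rewrite lee_fin mulr_ge0 ?exprn_ge0// point_mass_ge0.
apply: le_trans (nneseries_lim_ge n.+1 u0).
by rewrite big_nat_recr//= leeDr// sume_ge0// => i _; apply: u0.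
Qed.

Variables (N : nat -> R) (C : R).
Hypothesis N1 : forall n, 1 <= N n.
Hypothesis C1 : 1 <= C.
Hypothesis pN : forall j n, n%:R ^+ j.+1.*2 * p n <= C * \prod_(i < j) N i ^+ 2.

(** The two spare powers in [pN] bound the [n]-th term by [D / n^2] for [n >= 2], a total of at most
    [D]. The terms [n = 0] and [n = 1] are at most [1 <= D] each; hence the factor [3]. *)
Lemma even_moment_le j :
  (\int[P]_t (X t ^+ j.*2)%:E <= (3 * C * \prod_(i < j) N i ^+ 2)%:E)%E.
Proof.
rewrite moment_series; apply: nneseries_le_fin => [n _|m].
  by rewrite mulr_ge0 ?exprn_ge0// point_mass_ge0.
set D := C * \prod_(i < j) N i ^+ 2.
have D1 : 1 <= D.
  apply: mulr_ege1 => //; elim/big_ind : _ => // [x y|i _]; first exact: mulr_ege1.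
  by apply: exprn_ege1.
have D0 : 0 <= D by exact: le_trans D1.
have term n : n%:R ^+ j.*2 * p n <=
    D * ((n == 0%N)%:R + (n == 1%N)%:R + (2 <= n)%:R / n%:R ^+ 2).
  case: n => [|[|n]].
  - rewrite /= mul0r !addr0 mulr1 expr0n double_eq0.
    case: (j == 0%N); rewrite ?mul0r//.
    by rewrite mul1r (le_trans (point_mass_le1 _)).
  - by rewrite /= mul0r addr0 add0r mulr1 expr1n mul1r (le_trans (point_mass_le1 _)).
  - rewrite /= !add0r mul1r; have := pN j n.+2.
    by rewrite doubleS -(addn2 j.*2) exprD mulrAC ler_pdivlMr// exprn_gt0.
have ind a : \sum_(0 <= n < m) (n == a)%:R <= 1 :> R.
  have -> : \sum_(0 <= n < m) (n == a)%:R = (a < m)%:R :> R; last by case: (_ < _)%N.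
  elim: m => [|m IH]; first by rewrite big_geq.
  rewrite big_nat_recr//= IH ltnS (leq_eqVlt a) eq_sym.
  by have [->|] := eqVneq a m; rewrite /= ?ltnn ?add0r ?addr0.
apply: (le_trans (ler_sum _ (fun n _ => term n))).
have -> : 3 * C * \prod_(i < j) N i ^+ 2 = D * 3 by rewrite /D; ring.
rewrite -mulr_sumr !big_split/= ler_wpM2l//.
by have := sum_inv_sq_le R m (leqnn 2); have := ind 0%N; have := ind 1%N; lra.
Qed.

Hypothesis N_nd : {homo N : m n / (m <= n)%N >-> m <= n}.

Let C3 : 1 <= 3 * C. Proof. by apply: mulr_ege1; rewrite ?ler1n. Qed.

(** Integer values give [X^k <= X^(2k)]. This crude doubling matches the exponent [-1 / (2k)] of the
    Stieltjes form of Carleman's condition. *)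
Lemma moment_le_expn k : (0 < k)%N ->
  (\int[P]_t (X t ^+ k)%:E <= ((3 * C * N k) ^+ k.*2)%:E)%E.
Proof.
move=> k0; have mXn m : measurable_fun setT (EFin \o (fun t => X t ^+ m)).
  by apply/measurable_EFinP; exact: measurable_funX.
apply: (@le_trans _ _ (\int[P]_t (X t ^+ k.*2)%:E)%E).
  apply: ge0_le_integral => //.
  - by move=> t _; rewrite lee_fin; have /natrP[n ->] := natX t; rewrite exprn_ge0.
  - exact: mXn.
  - exact: mXn.
  - move=> t _; rewrite lee_fin; have /natrP[[|n] ->] := natX t.
      by rewrite !expr0n double_eq0.
    by rewrite ler_weXn2l ?ler1n// -addnn leq_addl.
apply: (le_trans (even_moment_le k)); rewrite lee_fin exprMn.
apply: ler_pM; [exact: le_trans C3| |by rewrite ler_eXnr// double_gt0|].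
  by apply: prodr_ge0 => i _; exact: sqr_ge0.
rewrite -muln2 mulnC exprM -[k in leRHS]card_ord -prodr_const.
have N0 i : 0 <= N i by exact: le_trans (N1 i).
apply: ler_prod => i _; rewrite sqr_ge0/=; apply: lerXn2r; rewrite ?nnegrE//.
by apply: N_nd; rewrite ?card_ord ltnW.
Qed.

Lemma powR_moment_ge k : (0 < k)%N -> 0 < p 1 ->
  (3 * C * N k)^-1 <= fine (\int[P]_t (X t ^+ k)%:E) `^ (- (2 * k%:R)^-1).
Proof.
move=> k0 p1; set e := fine _.
have B1 : 1 <= 3 * C * N k by apply: mulr_ege1.
have B0 : 0 < 3 * C * N k by exact: lt_le_trans B1.
have eE : (\int[P]_t (X t ^+ k)%:E = e%:E)%E.
  rewrite fineK// ge0_fin_numE; last first.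
    apply: integral_ge0 => t _; rewrite lee_fin.
    by have /natrP[n ->] := natX t; rewrite exprn_ge0.
  exact: le_lt_trans (moment_le_expn k0) (ltry _).
(* The mass at [1] keeps the moment positive; a real power of [0] with nonzero exponent is [0] by
   convention, which would spoil the lower bound. *)
have e0 : 0 < e.
  have := term_le_moment k 1; rewrite eE lee_fin expr1n mul1r.
  exact: lt_le_trans.
have eB : e <= (3 * C * N k) ^+ k.*2 by rewrite -lee_fin -eE moment_le_expn.
rewrite powRN lef_pV2 ?posrE ?powR_gt0//.
have k2 : 2 * k%:R != 0 :> R by rewrite mulf_neq0// pnatr_eq0 -lt0n.
have -> : 3 * C * N k = ((3 * C * N k) ^+ k.*2) `^ ((2 * k%:R)^-1).
  rewrite -powR_mulrn; last exact: ltW.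
  by rewrite -powRrM -mul2n natrM divff// powRr1// ltW.
apply: ge0_ler_powR => //; rewrite ?nnegrE ?invr_ge0 ?mulr_ge0// ?exprn_ge0//.
- exact: ltW.
- exact: ltW.
Qed.

Hypothesis N_div : forall K : R, exists n, K <= \sum_(i < n) (N i)^-1.

Lemma carleman_series : 0 < p 1 ->
  (\sum_(1 <= k <oo)
     (fine (\int[P]_t (X t ^+ k)%:E) `^ (- (2 * k%:R)^-1))%:E = +oo)%E.
Proof.
move=> p1; apply/eqyP => K K0.
(* The factor [3 * C] offsets the constant of [powR_moment_ge], and [(N 0)^-1] the fact that the
   series starts at [1]. *)
have [n hn] := N_div (3 * C * K + 1 + (N 0)^-1).
apply: le_trans (nneseries_lim_ge n _); last first.
  by move=> k _ _; rewrite lee_fin powR_ge0.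
rewrite sumEFin lee_fin.
apply: (@le_trans _ _ (\sum_(1 <= k < n) (3 * C * N k)^-1)); last first.
  by rewrite !big_nat; apply: ler_sum => k /andP[k0 _]; exact: powR_moment_ge.
have h : \sum_(i < n) (N i)^-1 <= (N 0)^-1 + \sum_(1 <= k < n) (N k)^-1.
  rewrite -(big_mkord xpredT (fun i => (N i)^-1)); case: n {hn} => [|n].
    by rewrite !big_geq// addr0 invr_ge0 (le_trans _ (N1 0)).
  by rewrite big_ltn.
under eq_bigr do rewrite invfM; rewrite -mulr_sumr ler_pdivlMl ?(lt_le_trans _ C3)//.
by move: hn h; set u := (N 0)^-1; lra.
Qed.

End nat_valued_moments.

(** * Determinacy on the half-line *)

Section determinacy.
Context (R : realType).

(** Two probability spaces and even moments only: this form covers both [Y] and [Y^2], with [X2] a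
    function on the real line under the competing law. *)
Lemma moments_determine_law (N : nat -> R) (C : R) :
  (forall n, 1 <= N n) -> {homo N : m n / (m <= n)%N >-> m <= n} ->
  (forall K : R, exists n, K <= \sum_(i < n) (N i)^-1) -> 1 <= C ->
  forall d1 d2 (T1 : measurableType d1) (T2 : measurableType d2)
    (P1 : probability T1 R) (P2 : probability T2 R) (X1 : T1 -> R) (X2 : T2 -> R),
  measurable_fun setT X1 -> measurable_fun setT X2 ->
  (forall t, X1 t \is a Num.nat) -> (forall t, 0 <= X2 t) ->
  (forall j n, n%:R ^+ j.+1.*2 * fine (P1 (X1 @^-1` [set n%:R]))
     <= C * \prod_(i < j) N i ^+ 2) ->
  (forall j, \int[P2]_t (X2 t ^+ j.*2)%:E = \int[P1]_t (X1 t ^+ j.*2)%:E)%E ->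
  forall B : set R, measurable B -> P2 (X2 @^-1` B) = P1 (X1 @^-1` B).
Proof.
move=> N1 Nnd Ndiv C1 d1 d2 T1 T2 P1 P2 X1 X2 mX1 mX2 X1n X20 pN mom B mB.
apply/esym; apply: (eq_law_of_cos mX1 mX2) => // s s0.
apply: (@eq_cos_transform R N (3 * C)) => //.
- by rewrite mulr_ge0// (le_trans _ C1).
- by move=> n; exact: lt_le_trans (N1 n).
- by move=> t; have /natrP[n ->] := X1n t.
- exact: even_moment_le.
Qed.

Variable mu : probability R R.
Hypothesis mu0 : mu `[0, +oo[%classic = 1%E.

Let mI : measurable (`[0, +oo[%classic : set R).
Proof. exact: measurable_itv. Qed.

Let muCI : mu (~` `[0, +oo[%classic) = 0%E.
Proof. by rewrite probability_setC// mu0 subee. Qed.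

Lemma ae_ge0 : {ae mu, forall x, 0 <= x}.
Proof.
exists (~` `[0, +oo[%classic); split => //; first exact: measurableC.
by move=> x /=; rewrite in_itv/= andbT.
Qed.

(** Serves to undo [|x|] and [(sqrt x)^2], which equal [x] only on the half-line. *)
Lemma eq_measure_ge0 (A B : set R) : measurable A -> measurable B ->
  (forall x, 0 <= x -> A x <-> B x) -> mu A = mu B.
Proof.
move=> mA mB AB.
have muI E : measurable E -> mu E = mu (E `&` `[0, +oo[%classic).
  move=> mE; rewrite (measureDI mu mE mI).
  rewrite (@subset_measure0 _ _ _ mu (E `\` `[0, +oo[%classic) (~` `[0, +oo[%classic)) ?add0e//.
  - exact: measurableD.
  - exact: measurableC.
rewrite (muI A)// (muI B)//; congr (mu _); apply/seteqP.
by split=> x [] + /=; rewrite in_itv/= andbT => xA x0; split=> //; apply/AB.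
Qed.

End determinacy.

Theorem theorem4 (d : measure_display) (T : measurableType d) (R : realType)
    (P : probability T R) (Y : {dRV P >-> R}) (p : nat -> R) (n0 : nat)
    (hY : forall t : T, exists n : nat, Y t = n%:R)
    (hp : forall n : nat, p n = pmf (P := P) Y n%:R)
    (hp0 : forall n : nat, 0 < p n)
    (hp1 : (\sum_(0 <= n <oo) (p n)%:E = 1)%E)
    (hmom : forall k : nat, ('E_P[(Y : T -> R) ^+ k] < +oo)%E)
    (hn0 : (2 <= n0)%N)
    (hdiv : (\sum_(n0 <= n <oo)
               (- ln (p n) / (n%:R ^+ 2 * ln n%:R))%:E = +oo)%E)
    (hincr : forall m n : nat, (n0 <= m)%N -> (m <= n)%N ->
       - ln (2^-1 * p m) / ln m%:R <= - ln (2^-1 * p n) / ln n%:R)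
    (hlim : - ln (2^-1 * p n) / ln n%:R @[n --> \oo] --> +oo) :
  [/\ Carleman_Stieltjes P Y,
      M_determinate P Y &
      M_determinate P ((Y : {mfun T >-> R}) ^+ 2)].
Proof.
have natY t : Y t \is a Num.nat by have [n ->] := hY t; apply/natrP; exists n.
have mY : measurable_fun setT (Y : T -> R) by exact: measurable_funPT.
have pE n : fine (P (Y @^-1` [set n%:R])) = p n by rewrite hp.
have momE k : ('E_P[(Y : T -> R) ^+ k] = \int[P]_t (Y t ^+ k)%:E)%E.
  by rewrite unlock; apply: eq_integral => t _; rewrite fctE.
have p1 n : p n <= 1 by rewrite -pE; exact: point_mass_le1.
(* The second moment bounds each [n^2 * p n], the base case of [pow_p_le]; the summand [2] covers
   the bound of [pow_mul_p]. *)
pose C := 2 + fine (\int[P]_t (Y t ^+ 2)%:E)%E.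
have m2 : 0 <= fine (\int[P]_t (Y t ^+ 2)%:E)%E.
  by rewrite fine_ge0// integral_ge0// => t _; rewrite lee_fin sqr_ge0.
have C2 : 2 <= C by rewrite lerDl.
have psq n : n%:R ^+ 2 * p n <= C.
  rewrite (@le_trans _ _ (fine (\int[P]_t (Y t ^+ 2)%:E)%E))//; last by rewrite lerDr.
  rewrite -lee_fin fineK; first by rewrite -pE; exact: (term_le_moment P mY natY 2 n).
  rewrite ge0_fin_numE -?momE//.
  by rewrite momE integral_ge0// => t _; rewrite lee_fin sqr_ge0.
have [N [N1 Nnd Ndiv pN]] :=
  exists_growth_sequence hp0 p1 hn0 C2 psq hdiv hincr hlim.
have C1 : 1 <= C by rewrite (le_trans _ C2)// ler1n.
have pN' j n : n%:R ^+ j.+1.*2 * fine (P (Y @^-1` [set n%:R]))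
    <= C * \prod_(i < j) N i ^+ 2 by rewrite pE.
have Y0 t : 0 <= Y t by have [n ->] := hY t.
split.
- rewrite /Carleman_Stieltjes; under eq_eseriesr do rewrite momE.
  by apply: (carleman_series mY natY N1 C1 pN' Nnd Ndiv); rewrite pE.
- split=> // mu mu0 mommu A mA.
  rewrite /distribution/= /pushforward.
  (* [X2] has to be nonnegative everywhere, whereas [mu] is only concentrated on the half-line;
     [|x|] has the same even powers as [x]. *)
  have mN : measurable_fun setT (fun x : R => `|x|).
    by apply: continuous_measurable_fun; exact: norm_continuous.
  rewrite -(moments_determine_law (P2 := mu) N1 Nnd Ndiv C1 mY mN natY _ pN')//; last first.
    move=> j; rewrite -momE -mommu; apply: eq_integral => x _.
    by rewrite -muln2 mulnC !exprM real_normK ?num_real.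
  apply: (eq_measure_ge0 mu0) => //; first by rewrite -[X in measurable X]setTI; exact: mN.
  by move=> x x0 /=; rewrite ger0_norm.
- have Y2E t : ((Y : {mfun T >-> R}) ^+ 2 : T -> R) t = Y t ^+ 2 by [].
  have mom2E k : ('E_P[((Y : {mfun T >-> R}) ^+ 2 : T -> R) ^+ k]
      = \int[P]_t (Y t ^+ k.*2)%:E)%E.
    rewrite unlock; apply: eq_integral => t _.
    by rewrite fctE Y2E -exprM mul2n.
  split; first by move=> t; rewrite Y2E sqr_ge0.
    by move=> k; rewrite mom2E -momE.
  move=> mu mu0 mommu A mA.
  rewrite /distribution/= /pushforward.
  (* Under [mu] the square root plays the part of [Y]: its power [2 j] is [x^j] almost everywhere,
     so all moments of [mu] become even moments. *)
  have mS : measurable_fun setT (@Num.sqrt R).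
    by apply: continuous_measurable_fun; exact: sqrt_continuous.
  pose B := (fun x : R => x ^+ 2) @^-1` A.
  have mB : measurable B.
    rewrite -[B]setTI; apply: (measurable_funX 2 (@measurable_id _ _ setT)) => //.
  have -> : ((Y : {mfun T >-> R}) ^+ 2 : T -> R) @^-1` A = Y @^-1` B by [].
  rewrite -(moments_determine_law (P2 := mu) N1 Nnd Ndiv C1 mY mS natY _ pN')//; last first.
    move=> j; rewrite -mom2E -mommu; apply: ae_eq_integral => //.
    - by apply/measurable_EFinP; exact: measurable_funX.
    - by apply/measurable_EFinP; exact: measurable_funX.
    - apply: filterS (ae_ge0 mu0) => x x0 _.
      by rewrite -mul2n exprM sqr_sqrtr.
  apply: (eq_measure_ge0 mu0) => //; first by rewrite -[X in measurable X]setTI; exact: mS.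
  by move=> x x0; rewrite /B/= sqr_sqrtr.
Qed.
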